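(* Let $k$ be a field. The additive categories $\mathsf{Top}^{\mathsf{sc}}_{\mathbb Z}$ (complete, separated topological abelian groups with linear topology) and $\mathsf{Top}^{\mathsf{sc}}_k$ (complete, separated topological $k$-vector spaces with linear topology) are right quasi-abelian. In other words, all kernels in $\mathsf{Top}^{\mathsf{sc}}_{\mathbb Z}$ and in $\mathsf{Top}^{\mathsf{sc}}_k$ are semi-stable kernels, and consequently all semi-stable cokernels in these categories are stable cokernels.
   Context: All topological abelian groups have linear topology: open subgroups form a base of neighborhoods of zero. All topological $k$-vector spaces ($k$ a fixed field with the discrete topology) have linear topology: open vector subspaces form a base of neighborhoods of zero. The completion of $A$ is $A^{\wedge}=\varprojlim_{U\subset A}A/U$, with $U$ ranging over the open subgroups (resp. subspaces), topologized so that the kernels of the projections $A^{\wedge}\to A/U$ form a base of neighborhoods of zero. $A$ is separated (resp. complete) if the natural map $A\to A^{\wedge}$ is injective (resp. surjective). $\mathsf{Top}^{\mathsf{sc}}_{\mathbb Z}$ (resp. $\mathsf{Top}^{\mathsf{sc}}_k$) is the category of complete, separated topological abelian groups and continuous homomorphisms (resp. complete, separated topological $k$-vector spaces and continuous $k$-linear maps). These are additive categories in which all kernels and cokernels exist. Let $\mathsf A$ be an additive category with kernels and cokernels. A morphism is called a kernel (resp. a cokernel) if it is a kernel (resp. a cokernel) of some morphism in $\mathsf A$. $\mathsf A$ is right quasi-abelian if any pushout of a kernel is a kernel: for every kernel $A'\to A$ and every morphism $A'\to B'$, the morphism $B'\to B'\sqcup_{A'}A$ is a kernel. A morphism $A'\to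 A$ is a semi-stable kernel if for every morphism $A'\to B'$ the pushout $B=B'\sqcup_{A'}A$ exists and $B'\to B$ is a kernel. Dually, $A\to A''$ is a semi-stable cokernel if for every morphism $C''\to A''$ the pullback $C=C''\sqcap_{A''}A$ exists and $C\to C''$ is a cokernel. A stable kernel is a semi-stable kernel whose cokernel is a semi-stable cokernel; a stable cokernel is a semi-stable cokernel whose kernel is a semi-stable kernel. *)

(* Defs.v *)
From HB Require Import structures.
From mathcomp Require Import all_boot all_order all_algebra.
From mathcomp Require Import all_classical all_reals topology tvs.

Set Implicit Arguments.
Unset Strict Implicit.
Unset Printing Implicit Defensive.

Import GRing.Theory.
Local Open Scope classical_set_scope.
Local Open Scope ring_scope.

(** * Additive categories *)

Record preadditive := Preadditive {
  obj :> Type;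
  mor : obj -> obj -> zmodType;
  idm : forall A, mor A A;
  mcomp : forall A B C, mor B C -> mor A B -> mor A C;
  compA : forall A B C D (h : mor C D) (g : mor B C) (f : mor A B),
    mcomp h (mcomp g f) = mcomp (mcomp h g) f;
  comp1m : forall A B (f : mor A B), mcomp (idm B) f = f;
  compm1 : forall A B (f : mor A B), mcomp f (idm A) = f;
  compDl : forall A B C (g1 g2 : mor B C) (f : mor A B),
    mcomp (g1 + g2) f = mcomp g1 f + mcomp g2 f;
  compDr : forall A B C (g : mor B C) (f1 f2 : mor A B),
    mcomp g (f1 + f2) = mcomp g f1 + mcomp g f2 }.

Arguments mor {p} A B.
Arguments idm {p} A.
Arguments mcomp {p A B C} g f.

Section Additive.
Variable C : preadditive.
Implicit Types A B P Z : C.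

Definition is_zero_object Z :=
  forall A, (forall f : mor A Z, f = 0) /\ (forall f : mor Z A, f = 0).

Definition is_biproduct A B P
    (i1 : mor A P) (i2 : mor B P) (p1 : mor P A) (p2 : mor P B) :=
  [/\ mcomp p1 i1 = idm A, mcomp p2 i2 = idm B, mcomp p2 i1 = 0, mcomp p1 i2 = 0
    & mcomp i1 p1 + mcomp i2 p2 = idm P].

Definition is_additive :=
  (exists Z, is_zero_object Z) /\
  (forall A B, exists P (i1 : mor A P) (i2 : mor B P)
     (p1 : mor P A) (p2 : mor P B), is_biproduct i1 i2 p1 p2).

(** * Kernels, cokernels, pushouts and pullbacks *)

Definition is_kernel_of K A B (i : mor K A) (f : mor A B) :=
  mcomp f i = 0 /\
  forall T (t : mor T A), mcomp f t = 0 -> exists! u : mor T K, mcomp i u = t.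

Definition is_cokernel_of A B Q (p : mor B Q) (f : mor A B) :=
  mcomp p f = 0 /\
  forall T (t : mor B T), mcomp t f = 0 -> exists! u : mor Q T, mcomp u p = t.

Definition has_kernels :=
  forall A B (f : mor A B), exists K (i : mor K A), is_kernel_of i f.

Definition has_cokernels :=
  forall A B (f : mor A B), exists Q (p : mor B Q), is_cokernel_of p f.

Definition is_kernel K A (i : mor K A) :=
  exists B (f : mor A B), is_kernel_of i f.

Definition is_cokernel B Q (p : mor B Q) :=
  exists A (f : mor A B), is_cokernel_of p f.

Definition is_pushout A' A B' B
    (i : mor A' A) (g : mor A' B') (j : mor B' B) (h : mor A B) :=
  mcomp j g = mcomp h i /\
  forall T (s : mor B' T) (t : mor A T), mcomp s g = mcomp t i ->
    exists! u : mor B T, mcomp u j = s /\ mcomp u h = t.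

Definition is_pullback A A'' C'' P
    (p : mor A A'') (g : mor C'' A'') (q : mor P C'') (h : mor P A) :=
  mcomp g q = mcomp p h /\
  forall T (s : mor T C'') (t : mor T A), mcomp g s = mcomp p t ->
    exists! u : mor T P, mcomp q u = s /\ mcomp h u = t.

(** * Right quasi-abelian categories, (semi-)stable kernels and cokernels *)

Definition right_quasi_abelian :=
  [/\ is_additive, has_kernels, has_cokernels
    & forall A' A B' B (i : mor A' A) (g : mor A' B')
        (j : mor B' B) (h : mor A B),
        is_kernel i -> is_pushout i g j h -> is_kernel j].

Definition semi_stable_kernel A' A (i : mor A' A) :=
  forall B' (g : mor A' B'),
    exists B (j : mor B' B) (h : mor A B), is_pushout i g j h /\ is_kernel j.

Definition semi_stable_cokernel A A'' (p : mor A A'') :=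
  forall C'' (g : mor C'' A''),
    exists P (q : mor P C'') (h : mor P A), is_pullback p g q h /\ is_cokernel q.

Definition stable_kernel A' A (i : mor A' A) :=
  semi_stable_kernel i /\
  exists A'' (p : mor A A''), is_cokernel_of p i /\ semi_stable_cokernel p.

Definition stable_cokernel A A'' (p : mor A A'') :=
  semi_stable_cokernel p /\
  exists A' (i : mor A' A), is_kernel_of i p /\ semi_stable_kernel i.

End Additive.

(** * Completions *)

Section Completion.
Variables (A : zmodType) (F : set (set A)).

Definition add_coset (U : set A) (a : A) : set A := [set a + u | u in U].

Definition add_quotient (U : set A) := {X : set A | exists a, X = add_coset U a}.

Definition to_add_quotient (U : set A) (a : A) : add_quotient U :=
  exist _ (add_coset U a) (ex_intro _ a erefl).

(* For subgroups U `<=` V, the projection A/U -> A/V sends a coset of U to the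
   unique coset of V containing it; so [completion_compat] says that this
   projection maps c U to c V, and [completion] is the limit of the A/U. *)
Record completion := Completion {
  completion_proj :> forall U : {U : set A | F U}, add_quotient (sval U);
  completion_compat : forall U V : {U : set A | F U}, sval U `<=` sval V ->
    sval (completion_proj U) `<=` sval (completion_proj V) }.

Lemma to_completion_compat (a : A) (U V : {U : set A | F U}) :
  sval U `<=` sval V ->
  sval (to_add_quotient (sval U) a) `<=` sval (to_add_quotient (sval V) a).
Proof. exact: image_subset. Qed.

Definition to_completion (a : A) : completion :=
  Completion (@to_completion_compat a).

Definition is_separated := forall a b, to_completion a = to_completion b -> a = b.

Definition is_complete := forall c : completion, exists a, to_completion a = c.

End Completion.

Definition base_at_zero (A : topologicalZmodType) (F : set (set A)) :=
  forall N : set A, nbhs (0 : A) N -> exists2 U, F U & U `<=` N.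

(** * Complete, separated topological abelian groups with linear topology *)

Definition open_subgroup (A : topologicalZmodType) : set (set A) :=
  [set U | open U /\ @zmod_closed A [in U]].

Record topscZ := TopscZ {
  topscZ_sort :> topologicalZmodType;
  topscZ_linear : base_at_zero (@open_subgroup topscZ_sort);
  topscZ_separated : is_separated (@open_subgroup topscZ_sort);
  topscZ_complete : is_complete (@open_subgroup topscZ_sort) }.

Section ContinuousAdditive.
Variables A B : topologicalZmodType.

Definition cont_additive : {pred A -> B} :=
  fun f : A -> B => `[< @zmod_morphism A B f /\ continuous f >].

Lemma cont_additiveP (f : A -> B) :
  reflect (@zmod_morphism A B f /\ continuous f) (f \in cont_additive).
Proof. exact: asboolP. Qed.

Lemma cont_additive_zmod : zmod_closed cont_additive.
Proof.
split=> [|f g /cont_additiveP[fA fC] /cont_additiveP[gA gC]];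
  apply/cont_additiveP; split.
- by move=> x y; exact: esym (subr0 _).
- by move=> x; exact: cvg_cst.
- move=> x y; change (f (x - y) - g (x - y) = f x - g x - (f y - g y)).
  by rewrite fA gA !opprD !opprK addrACA.
- move=> x; apply: (@continuous_comp _ _ _ (fun x => (f x, g x))
    (fun z : B * B => z.1 - z.2)); last exact: sub_continuous.
  by apply: cvg_pair; [exact: fC|exact: gC].
Qed.

HB.instance Definition _ :=
  GRing.isZmodClosed.Build (A -> B) cont_additive cont_additive_zmod.

Record homZ := HomZ { homZ_fun :> A -> B; _ : homZ_fun \in cont_additive }.

HB.instance Definition _ := [isSub for homZ_fun].
HB.instance Definition _ := [Choice of homZ by <:].
HB.instance Definition _ := [SubChoice_isSubZmodule of homZ by <:].

Lemma homZ_ext (f g : homZ) : f =1 g -> f = g.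
Proof. by move=> fg; apply/val_inj/funext. Qed.

Lemma homZ_zmod_morphism (f : homZ) : zmod_morphism f.
Proof. by have /cont_additiveP[] := valP f. Qed.

HB.instance Definition _ (f : homZ) :=
  Algebra.isZmodMorphism.Build A B f (homZ_zmod_morphism f).

Lemma homZ_continuous (f : homZ) : continuous f.
Proof. by have /cont_additiveP[] := valP f. Qed.

End ContinuousAdditive.

Lemma homZ_id_subproof (A : topologicalZmodType) :
  (@idfun A) \in @cont_additive A A.
Proof. by apply/cont_additiveP; split=> // x; exact: cvg_id. Qed.

Definition homZ_id (A : topologicalZmodType) : homZ A A :=
  HomZ (@homZ_id_subproof A).

Lemma homZ_comp_subproof (A B C : topologicalZmodType)
  (g : homZ B C) (f : homZ A B) : (g \o f) \in @cont_additive A C.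
Proof.
apply/cont_additiveP; split=> x; first by move=> y /=; rewrite !raddfB.
by apply: continuous_comp; exact: homZ_continuous.
Qed.

Definition homZ_comp (A B C : topologicalZmodType)
    (g : homZ B C) (f : homZ A B) : homZ A C :=
  HomZ (homZ_comp_subproof g f).

Program Definition TopscZ_cat : preadditive :=
  @Preadditive topscZ (fun A B => homZ A B)
    (fun A => homZ_id A) (fun A B C => @homZ_comp A B C) _ _ _ _ _.
Next Obligation. by move=> *; exact: homZ_ext. Qed.
Next Obligation. by move=> *; exact: homZ_ext. Qed.
Next Obligation. by move=> *; exact: homZ_ext. Qed.
Next Obligation. by move=> *; exact: homZ_ext. Qed.
Next Obligation. by move=> A B C g f1 f2; apply: homZ_ext => x; exact: raddfD. Qed.

(** * Complete, separated topological vector spaces with linear topology *)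

(* [topologicalLmodType] needs a numDomainType of scalars with its order topology;
   here k is an arbitrary field with the discrete topology. *)
Record topVect (k : fieldType) := TopVect {
  topVect_group : topologicalZmodType;
  topVect_lmod : GRing.Zmodule_isLmodule k topVect_group;
  topVect_scale_continuous :
    continuous (fun z : discrete_topology k * topVect_group =>
      GRing.Zmodule_isLmodule.scale topVect_lmod z.1 z.2) }.

Definition topVect_sort (k : fieldType) (V : topVect k) : Type :=
  topVect_group V.
Coercion topVect_sort : topVect >-> Sortclass.

HB.instance Definition _ (k : fieldType) (V : topVect k) :=
  TopologicalZmodule.copy (topVect_sort V) (topVect_group V).
HB.instance Definition _ (k : fieldType) (V : topVect k) :
  GRing.Zmodule_isLmodule k (topVect_sort V) := topVect_lmod V.

Definition open_subspace (k : fieldType) (V : topVect k) : set (set V) :=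
  [set U | open U /\ @submod_closed k V [in U]].

Record topsck (k : fieldType) := Topsck {
  topsck_sort :> topVect k;
  topsck_linear : base_at_zero (@open_subspace k topsck_sort);
  topsck_separated : is_separated (@open_subspace k topsck_sort);
  topsck_complete : is_complete (@open_subspace k topsck_sort) }.

Section ContinuousLinear.
Variables (k : fieldType) (V W : topVect k).

Definition cont_linear : {pred V -> W} :=
  fun f : V -> W => `[< linear f /\ continuous f >].

Lemma cont_linearP (f : V -> W) :
  reflect (linear f /\ continuous f) (f \in cont_linear).
Proof. exact: asboolP. Qed.

Lemma cont_linear_zmod : zmod_closed cont_linear.
Proof.
split=> [|f g /cont_linearP[fL fC] /cont_linearP[gL gC]];
  apply/cont_linearP; split.
- by move=> a x y; change (0 = a *: 0 + 0 :> W); rewrite scaler0 addr0.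
- by move=> x; exact: cvg_cst.
- move=> a x y.
  change (f (a *: x + y) - g (a *: x + y) = a *: (f x - g x) + (f y - g y)).
  by rewrite fL gL scalerBr opprD addrACA.
- move=> x; apply: (@continuous_comp _ _ _ (fun x => (f x, g x))
    (fun z : W * W => z.1 - z.2)); last exact: sub_continuous.
  by apply: cvg_pair; [exact: fC|exact: gC].
Qed.

HB.instance Definition _ :=
  GRing.isZmodClosed.Build (V -> W) cont_linear cont_linear_zmod.

Record homk := Homk { homk_fun :> V -> W; _ : homk_fun \in cont_linear }.

HB.instance Definition _ := [isSub for homk_fun].
HB.instance Definition _ := [Choice of homk by <:].
HB.instance Definition _ := [SubChoice_isSubZmodule of homk by <:].

Lemma homk_ext (f g : homk) : f =1 g -> f = g.
Proof. by move=> fg; apply/val_inj/funext. Qed.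

Lemma homk_linear (f : homk) : linear f.
Proof. by have /cont_linearP[] := valP f. Qed.

HB.instance Definition _ (f : homk) :=
  GRing.isLinear.Build k V W *:%R f (homk_linear f).

Lemma homk_continuous (f : homk) : continuous f.
Proof. by have /cont_linearP[] := valP f. Qed.

End ContinuousLinear.

Section Topsck.
Variable k : fieldType.
Implicit Types U V W : topVect k.

Lemma homk_id_subproof V : (@idfun V) \in @cont_linear k V V.
Proof. by apply/cont_linearP; split=> // x; exact: cvg_id. Qed.

Definition homk_id V : homk V V := Homk (@homk_id_subproof V).

Lemma homk_comp_subproof U V W (g : homk V W) (f : homk U V) :
  (g \o f) \in @cont_linear k U W.
Proof.
apply/cont_linearP; split=> x; first by move=> y z /=; rewrite !linearP.
by apply: continuous_comp; exact: homk_continuous.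
Qed.

Definition homk_comp U V W (g : homk V W) (f : homk U V) : homk U W :=
  Homk (homk_comp_subproof g f).

Program Definition Topsck_cat : preadditive :=
  @Preadditive (topsck k) (fun A B => homk A B)
    (fun A => homk_id A) (fun A B C => @homk_comp A B C) _ _ _ _ _.
Next Obligation. by move=> *; exact: homk_ext. Qed.
Next Obligation. by move=> *; exact: homk_ext. Qed.
Next Obligation. by move=> *; exact: homk_ext. Qed.
Next Obligation. by move=> *; exact: homk_ext. Qed.
Next Obligation. by move=> A B C g f1 f2; apply: homk_ext => x; exact: raddfD. Qed.

End Topsck.

(* Main.v *)
From HB Require Import structures.
From mathcomp Require Import all_boot all_algebra.
From mathcomp Require Import all_classical topology tvs.
Require Import Defs.

(** Both categories are instances of one situation. Let R be a ring, the
    integers or the field k. A complete separated linear topology on an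
    R-module is determined by its set of open submodules, so the objects can
    be handled as modules with such a set ([lin_top]) and the morphisms as
    linear maps under which preimages of open submodules are open. The record
    [realization] says that a preadditive category is made of these objects and
    morphisms, and contains every such object up to isomorphism. The argument is
    carried out once for a realized category.

    All objects that have to be built are subquotients. If D is a submodule of M
    and B is a directed set of submodules for which D is complete, then D
    modulo the intersection of B is complete and separated
    ([complete_subquotient]). The zero object, biproducts and kernels are of
    this kind, and so is the completion of a quotient A/H: there D is the module
    of compatible families of elements of A, indexed by the open submodules
    containing H. The cokernel of a morphism is the completed quotient of its
    target by its image ([cokernel_exists]).

    The heart of the proof is that a morphism i : K -> A is a kernel if and only
    if K carries the topology induced from A ([embedding]). A kernel of f is
    isomorphic to the submodule of zeros of f with its induced topology.
    Conversely, if K has the induced topology, then it is closed in A because it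
    is complete ([embedding_closed]), and a closed subobject is the kernel of
    the projection onto its completed quotient, as the elements killed by that
    projection form the closure of the image of K.

    The pushout of i : A' -> A along g : A' -> B' is the cokernel of (g, -i) from
    A' to the biproduct of B' and A. Given an open U in B', the preimage of U
    under g is open in A', hence contains the preimage under i of an open V in A.
    If (b, 0) = (u, v) + (g a, - i a) with u in U and v in V, then i a = v, so
    g a is in U and b = u + g a is in U. Thus B' has the topology induced from
    the pushout ([pushout_exists]), and B' -> B is a kernel. Kernels being
    semi-stable, a semi-stable cokernel is stable as soon as it has a kernel. *)

Set Implicit Arguments.
Unset Strict Implicit.
Unset Printing Implicit Defensive.

Import GRing.Theory.
Local Open Scope classical_set_scope.
Local Open Scope ring_scope.

(** * Submodules and subquotient modules *)

Definition submod (R : pzRingType) (M : lmodType R) (U : set M) :=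
  U 0 /\ forall a x y, U x -> U y -> U (a *: x + y).

Section SubmodTheory.
Variables (R : pzRingType) (M : lmodType R).
Implicit Types (U V : set M) (B : set (set M)).

Lemma submodD U x y : submod U -> U x -> U y -> U (x + y).
Proof. by case=> _ UP Ux Uy; rewrite -(scale1r x); exact: UP. Qed.

Lemma submodZ U a x : submod U -> U x -> U (a *: x).
Proof. by case=> U0 UP Ux; rewrite -(addr0 (_ *: _)); exact: UP. Qed.

Lemma submodN U x : submod U -> U x -> U (- x).
Proof. by move=> Us Ux; rewrite -scaleN1r; exact: submodZ. Qed.

Lemma submodB U x y : submod U -> U x -> U y -> U (x - y).
Proof. by move=> Us Ux Uy; apply: submodD => //; exact: submodN. Qed.

Lemma submod_sym U x y : submod U -> U (x - y) -> U (y - x).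
Proof. by move=> Us Uxy; rewrite -opprB; exact: submodN. Qed.

Lemma submod_trans U y x z : submod U -> U (x - y) -> U (y - z) -> U (x - z).
Proof.
move=> Us Uxy Uyz; have := submodD Us Uxy Uyz.
by rewrite addrA subrK.
Qed.

Lemma submodT : submod [set: M].
Proof. by []. Qed.

Lemma submod0 : submod [set 0 : M].
Proof. by split=> // a x y -> ->; rewrite scaler0 addr0. Qed.

Lemma submodI U V : submod U -> submod V -> submod (U `&` V).
Proof.
move=> [U0 UP] [V0 VP]; split=> // a x y [Ux Vx] [Uy Vy].
by split; [exact: UP|exact: VP].
Qed.

Lemma submod_bigcap B :
  (forall U, B U -> submod U) -> submod [set x | forall U, B U -> U x].
Proof.
move=> BS; split=> [U BU|a x y Bx By U BU]; first by have [] := BS _ BU.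
by have [_] := BS _ BU; apply; [exact: Bx|exact: By].
Qed.

Lemma submod_add U V : submod U -> submod V ->
  submod [set x | exists u v, [/\ U u, V v & x = u + v]].
Proof.
move=> [U0 UP] [V0 VP]; split.
  by exists 0, 0; split=> //; rewrite addr0.
move=> a _ _ [u [v [Uu Vv ->]]] [u' [v' [Uu' Vv' ->]]].
exists (a *: u + u'), (a *: v + v'); split; [exact: UP|exact: VP|].
by rewrite scalerDr addrACA.
Qed.

Lemma submod_preimage (M' : lmodType R) (f : M -> M') (U : set M') :
  linear f -> submod U -> submod (f @^-1` U).
Proof.
move=> fL [U0 UP].
have f0 : f 0 = 0.
  by have := fL (-1) 0 0; rewrite scaler0 addr0 scaleN1r addNr.
by split=> [|a x y Ux Uy]; rewrite /preimage/= ?f0// fL; exact: UP.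
Qed.

End SubmodTheory.

Section Subquotient.
Variables (R : pzRingType) (M : lmodType R) (D N : set M).
Hypotheses (Dsub : submod D) (Nsub : submod N).

Definition crepr (x : M) : M := xget 0 [set y | D y /\ N (y - x)].

Lemma creprP x : D x -> D (crepr x) /\ N (crepr x - x).
Proof.
by move=> Dx; rewrite /crepr; case: xgetP => [y -> []//|/(_ x)]; case; split=> //;
   rewrite subrr; case: Nsub.
Qed.

Lemma crepr_eq x y : N (x - y) -> crepr x = crepr y.
Proof.
move=> Nxy; rewrite /crepr; congr xget; apply/seteqP; split=> z /= [Dz Nz];
  split=> //; apply: submod_trans Nz _ => //.
exact: submod_sym.
Qed.

(** The module D / (D inter N), carried by one chosen representative in each
    class; [crepr] depends on its argument only through its class, which makes
    the choice canonical. *)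
Record subquot := Subquot {
  sqval : M; _ : `[< D sqval /\ crepr sqval = sqval >] }.

HB.instance Definition _ := [isSub for sqval].
HB.instance Definition _ := [Choice of subquot by <:].

Lemma sqval_D q : D (sqval q).
Proof. by case: q => x /= /asboolP[]. Qed.

Lemma sqcls_subproof x :
  let y := crepr (if `[< D x >] then x else 0) in
  `[< D y /\ crepr y = y >].
Proof.
apply/asboolP; case: asboolP => [|_].
  by move=> /creprP[? ?]; split=> //; exact: crepr_eq.
have [D0 _] := Dsub; have [? ?] := creprP D0.
by split=> //; exact: crepr_eq.
Qed.

Definition sqcls x : subquot := Subquot (sqcls_subproof x).

Lemma sqvalK q : sqcls (sqval q) = q.
Proof.
apply: val_inj => /=; rewrite asboolT; last exact: sqval_D.
by case: q => x /= /asboolP[].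
Qed.

Lemma sqclsK x : D x -> N (sqval (sqcls x) - x).
Proof. by move=> Dx /=; rewrite asboolT//; have [] := creprP Dx. Qed.

Lemma sqcls_eq x y : D x -> D y -> N (x - y) -> sqcls x = sqcls y.
Proof.
by move=> Dx Dy Nxy; apply: val_inj; rewrite /= !asboolT//; exact: crepr_eq.
Qed.

Let sqadd p q := sqcls (sqval p + sqval q).
Let sqopp p := sqcls (- sqval p).
Let sqscale a p := sqcls (a *: sqval p).

Let DD x y : D x -> D y -> D (x + y). Proof. exact: submodD. Qed.
Let DN x : D x -> D (- x). Proof. exact: submodN. Qed.
Let DZ a x : D x -> D (a *: x). Proof. exact: submodZ. Qed.
Let D0 : D 0. Proof. by case: Dsub. Qed.

Let sqaddE x y : D x -> D y -> sqadd (sqcls x) (sqcls y) = sqcls (x + y).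
Proof.
move=> Dx Dy; apply: sqcls_eq; [|exact: DD|].
  by apply: DD; exact: sqval_D.
by rewrite opprD addrACA; apply: submodD => //; exact: sqclsK.
Qed.

Let sqscaleE a x : D x -> sqscale a (sqcls x) = sqcls (a *: x).
Proof.
move=> Dx; apply: sqcls_eq; [|exact: DZ|].
  by apply: DZ; exact: sqval_D.
by rewrite -scalerBr; apply: submodZ => //; exact: sqclsK.
Qed.

Let sqoppE x : D x -> sqopp (sqcls x) = sqcls (- x).
Proof.
move=> Dx; apply: sqcls_eq; [|exact: DN|].
  by apply: DN; exact: sqval_D.
by rewrite -opprD; apply: submodN => //; exact: sqclsK.
Qed.

Let sqW (P : subquot -> Prop) : (forall x, D x -> P (sqcls x)) -> forall q, P q.
Proof. by move=> PP q; rewrite -(sqvalK q); apply: PP; exact: sqval_D. Qed.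

Let sqaddA : associative sqadd.
Proof.
elim/sqW=> x Dx; elim/sqW=> y Dy; elim/sqW=> z Dz.
by rewrite !sqaddE ?addrA//; exact: DD.
Qed.

Let sqaddC : commutative sqadd.
Proof. by move=> p q; rewrite /sqadd addrC. Qed.

Let sqadd0 : left_id (sqcls 0) sqadd.
Proof. by elim/sqW=> x Dx; rewrite sqaddE ?add0r. Qed.

Let sqaddN : left_inverse (sqcls 0) sqopp sqadd.
Proof. by elim/sqW=> x Dx; rewrite sqoppE ?sqaddE ?addNr//; exact: DN. Qed.

HB.instance Definition _ :=
  GRing.isZmodule.Build subquot sqaddA sqaddC sqadd0 sqaddN.

Let sqscaleA a b v : sqscale a (sqscale b v) = sqscale (a * b) v.
Proof. by elim/sqW: v => x Dx; rewrite !sqscaleE ?scalerA//; exact: DZ. Qed.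

Let sqscale1 : left_id 1 sqscale.
Proof. by elim/sqW=> x Dx; rewrite sqscaleE// scale1r. Qed.

Let sqscaleDr : right_distributive sqscale +%R.
Proof.
move=> a; elim/sqW=> x Dx; elim/sqW=> y Dy.
rewrite -[LHS]/(sqscale a (sqadd _ _)) -[RHS]/(sqadd _ _).
by rewrite sqaddE// !sqscaleE//; [rewrite sqaddE ?scalerDr//; exact: DZ|exact: DD].
Qed.

Let sqscaleDl v : {morph sqscale^~ v : a b / a + b}.
Proof.
elim/sqW: v => x Dx a b /=.
by rewrite -[RHS]/(sqadd _ _) !sqscaleE// sqaddE ?scalerDl//; exact: DZ.
Qed.

HB.instance Definition _ :=
  GRing.Zmodule_isLmodule.Build R subquot sqscaleA sqscale1 sqscaleDr sqscaleDl.

(** The maps [p] and [s] are the projection of D and the choice of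
    representatives; [p] is a total function on M and is meaningful on D only. *)
Lemma subquotient_module : exists (Q : lmodType R) (p : M -> Q) (s : Q -> M),
  [/\ forall q, D (s q), cancel s p, forall x, D x -> N (s (p x) - x),
      forall x y, D x -> D y -> N (x - y) -> p x = p y &
      forall a x y, D x -> D y -> p (a *: x + y) = a *: p x + p y].
Proof.
exists subquot, sqcls, sqval; split; [exact: sqval_D|exact: sqvalK|exact: sqclsK|
  exact: sqcls_eq|].
move=> a x y Dx Dy; rewrite -[RHS]/(sqadd (sqscale _ _) _).
by rewrite sqscaleE// sqaddE//; exact: DZ.
Qed.

End Subquotient.

(** * Complete separated linear topologies *)

(** The open submodules of a complete separated linear topology. Completeness
    speaks of families [y] of elements indexed by all subsets, of which only the
    values at open submodules matter: such a compatible family is a point of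
    the limit of the quotients M/U. *)
Record lin_top (R : pzRingType) (M : lmodType R) (O : set (set M)) : Prop :=
  LinTop {
  lin_topS : forall U, O U -> submod U;
  lin_topT : O setT;
  lin_topI : forall U V, O U -> O V -> O (U `&` V);
  lin_top_up : forall U V, O U -> submod V -> U `<=` V -> O V;
  lin_top_sep : forall x, (forall U, O U -> U x) -> x = 0;
  lin_top_compl : forall y : set M -> M,
    (forall U V, O U -> O V -> U `<=` V -> V (y U - y V)) ->
    exists x, forall U, O U -> U (x - y U) }.

(** The Hausdorff quotient of D, for the topology that B induces on it. A
    compatible family in the quotient is lifted by the representatives [s] to a
    compatible family in D, as [s] is linear modulo every member of B; the image
    of a limit of the lifted family is a limit of the given one. *)
Lemma complete_subquotient (R : pzRingType) (M : lmodType R)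
    (D : set M) (B : set (set M)) :
  submod D -> (forall U, B U -> submod U) -> B !=set0 ->
  (forall U V, B U -> B V -> exists2 W, B W & W `<=` U `&` V) ->
  (forall y : set M -> M, (forall U, B U -> D (y U)) ->
    (forall U V, B U -> B V -> U `<=` V -> V (y U - y V)) ->
    exists2 x, D x & forall U, B U -> U (x - y U)) ->
  exists (Q : lmodType R) (O : set (set Q)) (p : M -> Q) (s : Q -> M),
    [/\ lin_top O,
        (forall W, O W -> exists2 U, B U & forall x, D x -> U x -> W (p x)) /\
          (forall U, B U -> O (s @^-1` U)),
        (forall q, D (s q)) /\ cancel s p,
        forall x U, D x -> B U -> U (s (p x) - x) &
        forall a x y, D x -> D y -> p (a *: x + y) = a *: p x + p y].
Proof.
move=> Ds BS [U0 BU0] BI Dcompl.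
have [Q [p [s [sD sK pK pN pP]]]] := subquotient_module Ds (submod_bigcap BS).
pose O := [set W : set Q |
  submod W /\ exists2 U, B U & forall x, D x -> U x -> W (p x)].
have D0 : D 0 by case: Ds.
have p0 : p 0 = 0.
  by have := pP (-1) 0 0 D0 D0; rewrite scaler0 addr0 scaleN1r addNr.
have pB x y : D x -> D y -> p (x - y) = p x - p y.
  by move=> Dx Dy; rewrite addrC -scaleN1r pP// scaleN1r addrC.
have sP U a q q' : B U -> U (s (a *: q + q') - (a *: s q + s q')).
  move=> BU; rewrite -{1}(sK q) -{1}(sK q') -pP//; apply: pK => //.
  by have [_] := Ds; apply.
have sB U q q' : B U -> U (s (q - q') - (s q - s q')).
  move=> BU; have := sP U (-1) q' q BU.
  by rewrite !scaleN1r addrC (addrC _ q) (addrC _ (s q)) addrC.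
have s0 U : B U -> U (s 0) by move=> BU; rewrite -p0 -[s _]subr0; exact: pK.
have OB U : B U -> O [set q | U (s q)].
  move=> BU; have Us := BS _ BU; split; last first.
    exists U => // x Dx Ux /=; rewrite -(subrK x (s _)); apply: submodD => //.
    exact: pK.
  split=> [|a q q' Uq Uq'] /=; first exact: s0.
  rewrite -(subrK (a *: s q + s q') (s _)); apply: submodD => //.
    exact: sP.
  by have [_] := Us; apply.
exists Q, O, p, s; split=> //; [|by split=> // W []|by move=> x U Dx BU; exact: pK].
split=> [W []//||U V|U V|q Wq|y yP].
- by split=> //; exists U0.
- move=> [Us [U' BU' UU']] [Vs [V' BV' VV']]; split; first exact: submodI.
  have [W BW WUV] := BI _ _ BU' BV'; exists W => // x Dx /WUV[U'x V'x].
  by split; [exact: UU'|exact: VV'].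
- move=> [_ [U' BU' UU']] Vs UV; split=> //.
  by exists U' => // x Dx U'x; exact/UV/UU'.
- rewrite -(sK q) -p0; apply: pN => // U BU; rewrite subr0.
  exact: Wq (OB _ BU).
- have := Dcompl (fun U => s (y [set q | U (s q)])).
  case=> [U BU|U V BU BV UV|x Dx xP]; first exact: sD.
    have Vs := BS _ BV.
    have := yP _ _ (OB _ BU) (OB _ BV) (fun q => UV (s q)).
    move=> /= /(submodB Vs)/(_ (sB V (y [set q | U (s q)])
      (y [set q | V (s q)]) BV)).
    by rewrite opprB addrC subrK.
  exists (p x) => W OW; have [Ws [U BU UW]] := OW.
  rewrite -(subrK (y [set q | U (s q)]) (p x)) -addrA; apply: submodD => //.
    rewrite -{1}(sK (y _)) -pB//; apply: UW; last exact: xP.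
    by apply: submodB => //; exact: sD.
  apply: yP => //; first exact: OB.
  by move=> q Uq; rewrite -(sK q); exact: UW.
Qed.

(** * Categories of complete separated linearly topologized modules *)

(** [mor_fun] is a fully faithful functor to the modules with a complete
    separated linear topology, essentially surjective by [realized]. Asking for
    an isomorphism in [realized], and not for an equality of modules, lets the
    objects of the category carry more structure than their module. *)
Record realization (R : pzRingType) (C : preadditive) := Realization {
  carrier : C -> lmodType R;
  opens : forall A : C, set (set (carrier A));
  mor_fun : forall A B : C, mor A B -> carrier A -> carrier B;
  op_top : forall A : C, lin_top (@opens A);
  ev_linear : forall (A B : C) (f : mor A B), linear (mor_fun f);
  ev_cont : forall (A B : C) (f : mor A B) U,
    @opens B U -> @opens A (mor_fun f @^-1` U);
  ev_inj : forall (A B : C) (f g : mor A B), mor_fun f =1 mor_fun g -> f = g;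
  ev_full : forall (A B : C) (h : carrier A -> carrier B), linear h ->
    (forall U, @opens B U -> @opens A (h @^-1` U)) ->
    exists f : mor A B, mor_fun f =1 h;
  ev1 : forall A : C, mor_fun (idm A) =1 id;
  evM : forall (A B D : C) (g : mor B D) (f : mor A B) x,
    mor_fun (mcomp g f) x = mor_fun g (mor_fun f x);
  evD : forall (A B : C) (f g : mor A B) x,
    mor_fun (f + g) x = mor_fun f x + mor_fun g x;
  realized : forall (M : lmodType R) (O : set (set M)), lin_top O ->
    exists (A : C) (e : M -> carrier A) (e' : carrier A -> M),
      [/\ linear e, cancel e e', cancel e' e &
          forall W, @opens A W <-> O (e @^-1` W)] }.

Arguments carrier {R C} r A.
Arguments opens {R C} r A _.
Arguments mor_fun {R C} r {A B} f.

HB.instance Definition _ (R : pzRingType) (C : preadditive)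
    (L : realization R C) (A B : C) (f : mor A B) :=
  GRing.isLinear.Build R (carrier L A) (carrier L B) *:%R (mor_fun L f)
    (@ev_linear R C L A B f).

Section Realized.
Variables (R : pzRingType) (C : preadditive) (L : realization R C).
Implicit Types A B K P Q T : C.
Local Notation car := (carrier L).
Local Notation op := (opens L).
Local Notation ev := (mor_fun L).

Lemma op_submod A U : op A U -> submod U.
Proof. exact: (lin_topS (op_top L A)). Qed.

Lemma opI A U V : op A U -> op A V -> op A (U `&` V).
Proof. exact: (lin_topI (op_top L A)). Qed.

Lemma op_up A U V : op A U -> submod V -> U `<=` V -> op A V.
Proof. exact: (lin_top_up (op_top L A)). Qed.

Lemma op0 A U : op A U -> U 0.
Proof. by move=> /op_submod[]. Qed.

Lemma op_eq A (x y : car A) : (forall U, op A U -> U (x - y)) -> x = y.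
Proof.
by move=> xy; apply/eqP; rewrite -subr_eq0; apply/eqP/(lin_top_sep (op_top L A)).
Qed.

Lemma ev0 A B x : ev (0 : mor A B) x = 0.
Proof. by apply: (addrI (ev (0 : mor A B) x)); rewrite -evD !addr0. Qed.

Lemma evN A B (f : mor A B) x : ev (- f) x = - ev f x.
Proof. by apply: (addrI (ev f x)); rewrite -evD !subrr ev0. Qed.

Lemma evB A B (f g : mor A B) x : ev (f - g) x = ev f x - ev g x.
Proof. by rewrite evD evN. Qed.

Lemma realized_subquotient (M : lmodType R) (D : set M) (B : set (set M)) :
  submod D -> (forall U, B U -> submod U) -> B !=set0 ->
  (forall U V, B U -> B V -> exists2 W, B W & W `<=` U `&` V) ->
  (forall y : set M -> M, (forall U, B U -> D (y U)) ->
    (forall U V, B U -> B V -> U `<=` V -> V (y U - y V)) ->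
    exists2 x, D x & forall U, B U -> U (x - y U)) ->
  exists (Q : C) (p : M -> car Q) (s : car Q -> M),
    [/\ forall W, op Q W -> exists2 U, B U & forall x, D x -> U x -> W (p x),
        forall U, B U -> op Q (s @^-1` U),
        (forall q, D (s q)) /\ cancel s p,
        forall x U, D x -> B U -> U (s (p x) - x) &
        forall a x y, D x -> D y -> p (a *: x + y) = a *: p x + p y].
Proof.
move=> Ds BS B0 BI Bc.
have [Q [O [p [s [OT [OW OU] [sD sK] spU pP]]]]] :=
  complete_subquotient Ds BS B0 BI Bc.
have [A [e [e' [eL eK e'K opA]]]] := realized L OT.
exists A, (e \o p), (s \o e'); split.
- by move=> W /opA/OW.
- move=> U BU; apply/opA; have := OU U BU; congr O.
  by apply: eq_set => q /=; rewrite eK.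
- by split=> q /=; rewrite ?sK.
- by move=> x U Dx BU /=; rewrite eK; exact: spU.
- by move=> a x y Dx Dy /=; rewrite pP// eL.
Qed.

(** When B separates the points of M, classes in the subquotient are singletons
    and the choice of representatives is the inclusion of D, with the induced
    topology. *)
Lemma realized_submodule (M : lmodType R) (D : set M) (B : set (set M)) :
  submod D -> (forall U, B U -> submod U) -> B !=set0 ->
  (forall U V, B U -> B V -> exists2 W, B W & W `<=` U `&` V) ->
  (forall x, (forall U, B U -> U x) -> x = 0) ->
  (forall y : set M -> M, (forall U, B U -> D (y U)) ->
    (forall U V, B U -> B V -> U `<=` V -> V (y U - y V)) ->
    exists2 x, D x & forall U, B U -> U (x - y U)) ->
  exists (Q : C) (s : car Q -> M),
    [/\ linear s /\ injective s, forall q, D (s q),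
        forall x, D x -> exists q, s q = x,
        forall W, op Q W -> exists2 U, B U & s @^-1` U `<=` W &
        forall U, B U -> op Q (s @^-1` U)].
Proof.
move=> Ds BS B0 BI Bsep Bc.
have [Q [p [s [OW OU [sD sK] spU pP]]]] := realized_subquotient Ds BS B0 BI Bc.
have spK x : D x -> s (p x) = x.
  move=> Dx; apply/eqP; rewrite -subr_eq0; apply/eqP/Bsep => U BU.
  exact: spU.
exists Q, s; split=> //.
- split; last exact: can_inj sK.
  move=> a q q'; rewrite -{1}(sK q) -{1}(sK q') -pP// spK//.
  by have [_] := Ds; apply.
- by move=> x Dx; exists (p x); exact: spK.
- move=> W /OW[U BU UW]; exists U => // q Uq; rewrite -(sK q).
  exact: UW.
Qed.

Lemma zero_object_exists : exists Z : C, is_zero_object Z.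
Proof.
have [||||||Z [s [[_ sI] sD _ _ _]]] :=
    @realized_submodule R^o [set 0] [set [set 0]].
- exact: submod0.
- by move=> U ->; exact: submod0.
- by exists [set 0].
- by move=> U V -> ->; exists [set 0].
- by move=> x /(_ [set 0]); apply.
- move=> y yD _; exists 0 => // U -> /=.
  by rewrite (yD [set 0])// subrr.
have Z0 (z : car Z) : z = 0.
  by apply: sI; rewrite !sD.
exists Z => A; split=> f; apply: (ev_inj (r := L)) => x; rewrite ev0.
  exact: Z0.
by rewrite (Z0 x) raddf0.
Qed.

Lemma biproduct_exists A B :
  exists P (i1 : mor A P) (i2 : mor B P) (p1 : mor P A) (p2 : mor P B),
    is_biproduct i1 i2 p1 p2.
Proof.
pose Bx := [set W : set (car A * car B) |
  exists U V, [/\ op A U, op B V & W = [set z | U z.1 /\ V z.2]]].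
have opTA := lin_topT (op_top L A); have opTB := lin_topT (op_top L B).
have BxU U V : op A U -> op B V -> Bx [set z | U z.1 /\ V z.2].
  by move=> oU oV; exists U, V.
have [||||||P [s [[sL sI] _ sO sW sU]]] :=
    @realized_submodule (car A * car B)%type setT Bx.
- exact: submodT.
- move=> _ [U [V [/op_submod[U0 UP] /op_submod[V0 VP] ->]]].
  split=> // a x y [Ux Vx] [Uy Vy]; split; [exact: UP|exact: VP].
- by exists [set z | [set: car A] z.1 /\ [set: car B] z.2], setT, setT.
- move=> _ _ [U [V [oU oV ->]]] [U' [V' [oU' oV' ->]]].
  exists [set z | (U `&` U') z.1 /\ (V `&` V') z.2].
    by exists (U `&` U'), (V `&` V'); split=> //; exact: opI.
  by move=> z [[? ?] [? ?]].
- move=> z zP; apply: injective_projections; apply: (@op_eq _) => U oU.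
    by rewrite subr0; case: (zP _ (BxU U setT oU opTB)).
  by rewrite subr0; case: (zP _ (BxU setT U opTA oU)).
- move=> y _ yP.
  have [U V oU oV UV|a aP] := lin_top_compl (op_top L A)
      (y := fun U => (y [set z | U z.1 /\ [set: car B] z.2]).1).
    by case: (yP _ _ (BxU U setT oU opTB) (BxU V setT oV opTB)) => // z [/UV].
  have [U V oU oV UV|b bP] := lin_top_compl (op_top L B)
      (y := fun U => (y [set z | [set: car A] z.1 /\ U z.2]).2).
    by case: (yP _ _ (BxU setT U opTA oU) (BxU setT V opTA oV)) => // z [_ /UV].
  exists (a, b) => // _ [U [V [oU oV ->]]]; split=> /=.
    apply: (submod_trans (op_submod oU) (aP U oU)).
    apply: submod_sym; first exact: op_submod oU.
    by case: (yP _ _ (BxU U V oU oV) (BxU U setT oU opTB)) => // z [].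
  apply: (submod_trans (op_submod oV) (bP V oV)).
  apply: submod_sym; first exact: op_submod oV.
  by case: (yP _ _ (BxU U V oU oV) (BxU setT V opTA oV)) => // z [].
have [p1 p1E] : exists p1 : mor P A, ev p1 =1 fst \o s.
  apply: ev_full => [a x y|U oU]; first by rewrite /= sL.
  apply: op_up (sU [set z | U z.1 /\ setT z.2] _) _ _; first by exists U, setT.
    apply: submod_preimage (op_submod oU) => a x y; first by rewrite /= sL.
  by move=> x [].
have [p2 p2E] : exists p2 : mor P B, ev p2 =1 snd \o s.
  apply: ev_full => [a x y|U oU]; first by rewrite /= sL.
  apply: op_up (sU [set z | setT z.1 /\ U z.2] _) _ _; first by exists setT, U.
    apply: submod_preimage (op_submod oU) => a x y; first by rewrite /= sL.
  by move=> x [].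
have /choice[r rK] : forall z, exists q, s q = z by move=> z; exact: sO.
have [i1 i1E] : exists i1 : mor A P, ev i1 =1 fun x => r (x, 0).
  have iL : linear (fun x => r (x, 0)).
    move=> a x y; apply: sI; rewrite sL !rK; congr pair.
    by rewrite /= scaler0 addr0.
  apply: ev_full => // W oW; have [_ [U [V [oU oV ->]]] UV] := sW _ oW.
  apply: op_up oU _ _; first exact: submod_preimage iL (op_submod oW).
  by move=> x Ux; apply: UV; rewrite /= rK; split=> //; exact: op0 oV.
have [i2 i2E] : exists i2 : mor B P, ev i2 =1 fun x => r (0, x).
  have iL : linear (fun x => r (0, x)).
    move=> a x y; apply: sI; rewrite sL !rK; congr pair.
    by rewrite /= scaler0 addr0.
  apply: ev_full => // W oW; have [_ [U [V [oU oV ->]]] UV] := sW _ oW.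
  apply: op_up oV _ _; first exact: submod_preimage iL (op_submod oW).
  by move=> x Ux; apply: UV; rewrite /= rK; split=> //; exact: op0 oU.
exists P, i1, i2, p1, p2; split; apply: (ev_inj (r := L)) => x.
- by rewrite evM ev1 p1E i1E /= rK.
- by rewrite evM ev1 p2E i2E /= rK.
- by rewrite evM ev0 p2E i1E /= rK.
- by rewrite evM ev0 p1E i2E /= rK.
- rewrite evD !evM ev1 i1E i2E p1E p2E /=; apply: sI.
  rewrite -[r _]scale1r sL !rK scale1r; case: (s x) => u v.
  by congr pair; rewrite /= ?addr0 ?add0r.
Qed.

(** * Kernels are the topological embeddings *)

(** The open submodules of K are generated by the preimages of those of A;
    injectivity follows because K is separated. *)
Definition embedding K A (i : mor K A) :=
  forall U, op K U -> exists2 V, op A V & ev i @^-1` V `<=` U.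

Lemma embedding_inj K A (i : mor K A) : embedding i -> injective (ev i).
Proof.
move=> ie x y xy; apply: (@op_eq _) => U /ie[V oV]; apply.
by rewrite /preimage/= raddfB/= xy subrr; exact: op0 oV.
Qed.

Lemma embedding_kernel_of K A B (i : mor K A) (f : mor A B) :
  embedding i -> mcomp f i = 0 ->
  (forall x, ev f x = 0 -> exists k, ev i k = x) -> is_kernel_of i f.
Proof.
move=> ie fi0 fK; split=> // T t ft0.
have /choice[u uP] : forall x, exists k, ev i k = ev t x.
  by move=> x; apply: fK; rewrite -evM ft0 ev0.
have uL : linear u.
  by move=> a x y; apply: (embedding_inj ie); rewrite !(ev_linear, uP).
have [v vE] : exists v : mor T K, ev v =1 u.
  apply: ev_full => // U oU; have [V oV VU] := ie U oU.
  apply: op_up (ev_cont t oV) _ _; first exact: submod_preimage uL (op_submod oU).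
  by move=> x Vx; apply: VU; rewrite /preimage/= uP.
exists v; split=> [|w wE]; apply: (ev_inj (r := L)) => x.
  by rewrite evM vE uP.
by apply: (embedding_inj ie); rewrite vE uP -wE evM.
Qed.

(** Let [x] lie in the closure of the image of K. Approximating [x] modulo
    smaller and smaller open submodules of A gives a compatible family in K,
    because A induces the topology of K; its limit is mapped to [x]. *)
Lemma embedding_closed K A (i : mor K A) x : embedding i ->
  (forall V, op A V -> exists k, V (x - ev i k)) -> exists k, ev i k = x.
Proof.
move=> ie xP.
have /choice[y yP] : forall U, exists k, op K U ->
    exists2 V, op A V & ev i @^-1` V `<=` U /\ V (x - ev i k).
  move=> U; have [oU|nU] := pselect (op K U); last by exists 0.
  have [V oV VU] := ie U oU; have [k kP] := xP V oV.
  by exists k => _; exists V.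
have yE U k V : op K U -> op A V -> ev i @^-1` V `<=` U -> V (x - ev i k) ->
    U (y U - k).
  move=> oU oV VU kV; have [V' oV' [VU' yV']] := yP U oU.
  have [k' [kV1 kV2]] := xP _ (opI oV oV').
  apply: (submod_trans (y := k') (op_submod oU)).
    apply: VU'; rewrite /preimage/= raddfB.
    apply: (submod_trans (y := x) (op_submod oV')) => //.
    exact: submod_sym (op_submod oV') _.
  apply: VU; rewrite /preimage/= raddfB.
  apply: (submod_trans (y := x) (op_submod oV)) => //.
  exact: submod_sym (op_submod oV) _.
have [U V oU oV UV|k kP] := lin_top_compl (op_top L K) (y := y).
  apply: submod_sym; first exact: op_submod oV.
  have [W oW [WU yW]] := yP U oU.
  by apply: yE oW _ yW => // z /WU/UV.
exists k; apply: (@op_eq _) => V oV.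
have oU := ev_cont i oV.
have [W oW [WV yW]] := yP _ oU.
have [k' [kV1 kV2]] := xP _ (opI oV oW).
have Vs := op_submod oV.
have := submod_trans (op_submod oU) (kP _ oU) (yE _ k' _ oU oV (fun=> id) kV1).
rewrite /preimage/= raddfB => Vkk'.
exact: (submod_trans Vs Vkk') (submod_sym Vs kV1).
Qed.

Lemma kernel_exists A B (f : mor A B) :
  exists K (i : mor K A), is_kernel_of i f /\ embedding i.
Proof.
have [||||||K [s [[sL sI] sD sO sW sU]]] :=
    @realized_submodule (car A) (ev f @^-1` [set 0]) (op A).
- exact: submod_preimage (ev_linear f) (submod0 _).
- exact: op_submod.
- by exists setT; exact: lin_topT (op_top L A).
- by move=> U V oU oV; exists (U `&` V) => //; exact: opI.
- exact: lin_top_sep (op_top L A).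
- move=> y yD yP; have [x xP] := lin_top_compl (op_top L A) yP.
  exists x => //; apply: (@op_eq _) => U oU; rewrite subr0.
  have oV := ev_cont f oU; have := xP _ oV.
  by rewrite /preimage/= raddfB/= (yD _ oV : ev f _ = 0) subr0.
have [i iE] : exists i : mor K A, ev i =1 s by apply: ev_full.
have ie : embedding i.
  move=> U /sW[V oV VU]; exists V => // x; rewrite /preimage/= iE; exact: VU.
exists K, i; split=> //; apply: embedding_kernel_of => //.
  by apply: (ev_inj (r := L)) => x; rewrite evM ev0 iE sD.
by move=> x /sO[k kE]; exists k; rewrite iE.
Qed.

(** The submodule of zeros with its induced topology is a kernel of the same
    morphism; the given kernel [i] factors through it by some [u], and [u] has a
    continuous left inverse [v], along which open submodules are transported. *)
Lemma kernel_embedding K A (i : mor K A) : is_kernel i -> embedding i.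
Proof.
move=> [B [f [fi0 iP]]]; have [K0 [i0 [[fi00 i0P] i0e]]] := kernel_exists f.
have [v [vE _]] := iP _ _ fi00; have [u [uE _]] := i0P _ _ fi0.
have vu : mcomp v u = idm K.
  have [w [wE wU]] := iP _ _ fi0.
  rewrite -(wU (mcomp v u)) ?compA ?vE//; apply: wU.
  by rewrite compm1.
move=> U oU; have [V oV VU] := i0e _ (ev_cont v oU); exists V => // x.
rewrite /preimage/= -uE evM => /VU; rewrite /preimage/= -evM vu ev1.
exact.
Qed.

(** * Completed quotients, cokernels and pushouts *)

(** The three properties that characterize the projection of A to the completion
    of A/H: it kills H, its image is dense, and the topology that it induces on
    A/H is not coarser than the quotient topology. *)
Definition completed_quotient A Q (p : mor A Q) (H : set (car A)) :=
  [/\ forall h, H h -> ev p h = 0,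
      forall q W, op Q W -> exists a, W (q - ev p a) &
      forall V, op A V -> H `<=` V ->
        exists2 W, op Q W & ev p @^-1` W `<=` V].

(** The completion is the module of compatible families of elements of A modulo
    null families, and A maps to it by constant families. *)
Lemma completed_quotient_exists A (H : set (car A)) : submod H ->
  exists Q (p : mor A Q), completed_quotient p H.
Proof.
move=> Hs; pose G := [set V | op A V /\ H `<=` V].
(* The values at all larger indices are constrained, so that [near] is
   monotone on arbitrary families: a base has to be directed in the whole
   module of families and not only among the compatible ones. *)
pose near V := [set c : set (car A) -> car A |
  forall V', G V' -> V `<=` V' -> V' (c V')].
pose D := [set c : set (car A) -> car A |
  forall U V, G U -> G V -> U `<=` V -> V (c U - c V)].
have GS V : G V -> submod V by move=> [/op_submod].
have GI U V : G U -> G V -> G (U `&` V).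
  move=> [oU HU] [oV HV]; split; first exact: opI.
  by move=> x Hx; split; [exact: HU|exact: HV].
have GT : G setT by split=> //; exact: lin_topT (op_top L A).
have nearS V : submod (near V).
  split=> [V' /GS[]//|a c c' cP c'P V' GV' VV'].
  by have [_] := GS _ GV'; apply; [exact: cP|exact: c'P].
have nearW U V : U `<=` V -> near U `<=` near V.
  by move=> UV c cP V' GV' VV'; apply: cP => //; exact: subset_trans VV'.
have DS : submod D.
  split=> [U V _ /GS[V0 _] _|a c c' cP c'P U V GU GV UV]; first by rewrite subrr.
  rewrite -[_ - _]/((a *: c U + c' U) - (a *: c V + c' V)).
  rewrite opprD addrACA -scalerBr; have [_] := GS _ GV.
  by apply; [exact: cP|exact: c'P].
have nearD c V : D c -> G V -> V (c V) -> near V c.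
  move=> Dc GV Vc V' GV' VV'; have V's := GS _ GV'.
  rewrite -[c V'](subrK (c V)); apply: submodD => //; last exact: VV'.
  by apply: submod_sym => //; exact: Dc.
have [||||Q [p [s [pW sU [sD sK] spU pP]]]] :=
    @realized_subquotient (set (car A) -> car A) D [set near V | V in G] DS.
- by move=> _ [V _ <-].
- by exists (near setT), setT.
- move=> _ _ [U GU <-] [V GV <-]; exists (near (U `&` V)).
    by exists (U `&` V) => //; exact: GI.
  by move=> c cP; split; apply: nearW cP => x [].
- move=> y yD yP.
  have Bn V : G V -> [set near V | V in G] (near V) by move=> GV; exists V.
  have yn U V : G U -> G V -> U `<=` V -> V (y (near U) V - y (near V) V).
    move=> GU GV UV.
    by apply: (yP _ _ (Bn U GU) (Bn V GV)) => //; exact: nearW.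
  exists (fun V => y (near V) V).
    move=> U V GU GV UV; apply: (submod_trans (y := y (near U) V) (GS _ GV)).
      by apply: (yD _ (Bn U GU)).
    exact: yn.
  move=> _ [U GU <-] V GV UV; apply: submod_sym; first exact: GS.
  exact: yn.
have Dc a : D (fun=> a).
  by move=> U V _ /GS[V0 _] _; rewrite subrr.
have pB x y : D x -> D y -> p (x - y) = p x - p y.
  move=> Dx Dy; have -> : x - y = -1 *: y + x by rewrite scaleN1r [RHS]addrC.
  by rewrite (pP (-1) y x Dy Dx) scaleN1r [RHS]addrC.
have [e eE] : exists e : mor A Q, ev e =1 fun a => p (fun=> a).
  have eL : linear (fun a => p (fun=> a)).
    by move=> a x y; exact: pP (Dc x) (Dc y).
  apply: ev_full => // W oW; have [_ [V GV <-] VW] := pW _ oW.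
  have [oV _] := GV.
  apply: op_up oV _ _; first exact: submod_preimage eL (op_submod oW).
  by move=> x Vx; apply: VW => //; exact: nearD.
exists Q, e; split.
- move=> h Hh; apply: (@op_eq _) => W oW; rewrite subr0 eE.
  have [_ [V GV <-] VW] := pW _ oW; apply: VW => //; apply: nearD => //.
  by have [_] := GV; apply.
- move=> q W oW; have [_ [V GV <-] VW] := pW _ oW; exists (s q V).
  rewrite eE -{1}(sK q) -pB//; apply: VW.
    exact: (submodB DS (sD q) (Dc _)).
  apply: nearD => //; first exact: (submodB DS (sD q) (Dc _)).
  by rewrite -[X in V X]/(s q V - s q V) subrr; case: (GS _ GV).
- move=> V oV HV; have GV : G V by [].
  have Bn : [set near V | V in G] (near V) by exists V.
  exists (s @^-1` near V); first exact: sU.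
  move=> x; rewrite /preimage/= eE => nx.
  have : near V (fun=> x).
    have := submodD (nearS V) (submod_sym (nearS V) (spU _ _ (Dc x) Bn)) nx.
    by rewrite subrK.
  by apply.
Qed.

(** Extension by continuity from a dense image: [u q] is the limit of [t a] as
    [p a] tends to [q]. *)
Lemma completed_quotient_ext A Q T (p : mor A Q) (H : set (car A))
    (t : mor A T) :
  completed_quotient p H -> (forall h, H h -> ev t h = 0) ->
  exists! u : mor Q T, mcomp u p = t.
Proof.
move=> [pH pd pV] tH.
have tU U : op T U -> exists2 W, op Q W & ev p @^-1` W `<=` ev t @^-1` U.
  move=> oU; apply: pV; first exact: ev_cont.
  by move=> h /tH h0; rewrite /preimage/= h0; exact: op0 oU.
have lim q : exists l, forall U a W, op T U -> op Q W ->
    ev p @^-1` W `<=` ev t @^-1` U -> W (q - ev p a) -> U (l - ev t a).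
  have /choice[y yP] : forall U, exists l, op T U -> exists a W,
      [/\ op Q W, ev p @^-1` W `<=` ev t @^-1` U, W (q - ev p a) & l = ev t a].
    move=> U; have [oU|nU] := pselect (op T U); last by exists 0.
    have [W oW WU] := tU U oU; have [a aW] := pd q W oW.
    by exists (ev t a) => _; exists a, W.
  have yE U a W : op T U -> op Q W -> ev p @^-1` W `<=` ev t @^-1` U ->
      W (q - ev p a) -> U (y U - ev t a).
    move=> oU oW WU aW; have [a' [W' [oW' W'U aW' ->]]] := yP U oU.
    have [b [bW bW']] := pd q _ (opI oW oW').
    have Us := op_submod oU; apply: (submod_trans (y := ev t b) Us).
      rewrite -raddfB; apply: W'U; rewrite /preimage/= raddfB.
      have W's := op_submod oW'.
      exact: submod_trans W's (submod_sym W's aW') bW'.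
    rewrite -raddfB; apply: WU; rewrite /preimage/= raddfB.
    have Ws := op_submod oW.
    exact: submod_trans Ws (submod_sym Ws bW) aW.
  have [U V oU oV UV|l lP] := lin_top_compl (op_top L T) (y := y).
    have [a [W [oW WU aW ->]]] := yP U oU.
    apply: submod_sym; first exact: op_submod oV.
    by apply: yE oW _ aW => // x /WU/UV.
  exists l => U a W oU oW WU aW; apply: (submod_trans (op_submod oU) (lP U oU)).
  exact: yE oW WU aW.
have /choice[u uP] := lim.
have uL : linear u.
  move=> c q q'; apply: (@op_eq _) => U oU; have Us := op_submod oU.
  have [W oW WU] := tU U oU; have Ws := op_submod oW.
  have [a aW] := pd q W oW; have [a' aW'] := pd q' W oW.
  apply: (submod_trans (y := ev t (c *: a + a')) Us).
    apply: (uP _ U _ W) => //; rewrite ev_linear opprD addrACA -scalerBr.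
    by have [_] := Ws; apply.
  rewrite ev_linear opprD addrACA -scalerBr; have [_] := Us; apply.
    by apply: submod_sym => //; exact: (uP _ U _ W).
  by apply: submod_sym => //; exact: (uP _ U _ W).
have [v vE] : exists v : mor Q T, ev v =1 u.
  apply: ev_full => // U oU; have [W oW WU] := tU U oU.
  apply: op_up (oW) _ _; first exact: submod_preimage uL (op_submod oU).
  move=> q Wq; rewrite /preimage/= -(subr0 (u q)) -(raddf0 (ev t)).
  by apply: (uP q U 0 W) => //; rewrite raddf0 subr0.
exists v; split=> [|w wp]; apply: (ev_inj (r := L)) => x.
  rewrite evM vE; apply: (@op_eq _) => U oU; have [W oW WU] := tU U oU.
  by apply: (uP _ U _ W) => //; rewrite subrr; exact: op0 oW.
rewrite vE; apply: (@op_eq _) => U oU; have [W oW WU] := tU U oU.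
have [a [aW aw]] := pd x _ (opI oW (ev_cont w oU)).
apply: (submod_trans (y := ev t a) (op_submod oU)).
  exact: (uP _ U _ W).
apply: submod_sym; first exact: op_submod oU.
by move: aw; rewrite /preimage/= raddfB/= -evM wp.
Qed.

Lemma submod_range A B (f : mor A B) : submod (range (ev f)).
Proof.
split=> [|a _ _ [x _ <-] [y _ <-]]; first by exists 0; rewrite ?raddf0.
by exists (a *: x + y); rewrite ?ev_linear.
Qed.

Lemma cokernel_exists A B (f : mor A B) : exists Q (p : mor B Q),
  is_cokernel_of p f /\ completed_quotient p (range (ev f)).
Proof.
have [Q [p pq]] := completed_quotient_exists (submod_range f).
have [p0 _ _] := pq; exists Q, p; split=> //; split.
  by apply: (ev_inj (r := L)) => x; rewrite evM ev0 p0//; exists x.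
move=> T t tf; apply: completed_quotient_ext pq _ => _ [x _ <-].
by rewrite -evM tf ev0.
Qed.

Lemma op_add A V (H : set (car A)) : op A V -> submod H ->
  op A [set x | exists v h, [/\ V v, H h & x = v + h]].
Proof.
move=> oV Hs; apply: op_up (oV) _ _; first exact: submod_add (op_submod oV) Hs.
by move=> x Vx; exists x, 0; split=> //; [case: Hs|rewrite addr0].
Qed.

(** The elements killed by the projection to the completed quotient lie in every
    open submodule V + i K, that is, in the closure of the image. *)
Lemma embedding_kernel K A (i : mor K A) : embedding i -> is_kernel i.
Proof.
move=> ie; have [Q [p [[pi0 _] [_ _ pV]]]] := cokernel_exists i.
exists Q, p; apply: (embedding_kernel_of ie) => // x px0.
apply: (embedding_closed ie) => V oV.
have [|W oW WV] := pV _ (op_add oV (submod_range i)).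
  by move=> h Hh; exists 0, h; split=> //; [exact: op0 oV|rewrite add0r].
have [|v [_ [Vv [k _ <-] ->]]] := WV x.
  by rewrite /preimage/= px0; exact: op0 oW.
by exists k; rewrite addrK.
Qed.

(** The pushout is the cokernel of [d], which is (g, -i). That the topology of B'
    is induced from it is a computation in the biproduct, since the open
    submodules of the cokernel pull back to sums of open ones with the
    range of [d]. *)
Lemma pushout_exists A' A B' (i : mor A' A) (g : mor A' B') : embedding i ->
  exists B (j : mor B' B) (h : mor A B), is_pushout i g j h /\ embedding j.
Proof.
move=> ie; have [P [i1 [i2 [p1 [p2 [p1i1 p2i2 p2i1 p1i2 i1p1]]]]]] :=
  biproduct_exists B' A.
pose d := mcomp i1 g - mcomp i2 i.
have [B [p [[pd pP] [_ _ pV]]]] := cokernel_exists d.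
have compN (X Y Z : C) (b : mor Y Z) (a : mor X Y) :
    mcomp b (- a) = - mcomp b a.
  by apply: (ev_inj (r := L)) => x; rewrite evM !evN raddfN/= evM.
have compB (X Y Z : C) (b : mor Y Z) (a a' : mor X Y) :
    mcomp b (a - a') = mcomp b a - mcomp b a'.
  by rewrite compDr compN.
exists B, (mcomp p i1), (mcomp p i2); split; last first.
  move=> U oU; have [V oV VU] := ie _ (ev_cont g oU).
  have oN := op_add (opI (ev_cont p1 oU) (ev_cont p2 oV)) (submod_range d).
  have [|W oW WN] := pV _ oN.
    move=> x Hx; exists 0, x; split=> //; last by rewrite add0r.
    by split; rewrite /preimage/= raddf0; [exact: op0 oU|exact: op0 oV].
  exists W => // b; rewrite /preimage/= evM => /WN[n [_ [[Un Vn] [a _ <-] bE]]].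
  have p2b : ev p2 (ev i1 b) = 0 by rewrite -evM p2i1 ev0.
  have p1b : ev p1 (ev i1 b) = b by rewrite -evM p1i1 ev1.
  have p1d : ev p1 (ev d a) = ev g a.
    by rewrite -evM compB !compA p1i1 p1i2 evB !evM ev1 ev0 subr0.
  have p2d : ev p2 (ev d a) = - ev i a.
    by rewrite -evM compB !compA p2i1 p2i2 evB !evM ev1 ev0 sub0r.
  rewrite -p1b bE raddfD/= p1d; apply: submodD => //; first exact: op_submod oU.
  apply: VU; rewrite /preimage/=.
  have : ev p2 n - ev i a = 0 by rewrite -p2d -raddfD -bE.
  by move=> /eqP; rewrite subr_eq0 => /eqP <-.
split.
  by apply/eqP; rewrite -!compA -subr_eq0 -compB; apply/eqP.
move=> T s t sg; pose w := mcomp s p1 + mcomp t p2.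
have wi1 : mcomp w i1 = s.
  rewrite compDl -!compA p1i1 p2i1 compm1.
  by apply: (ev_inj (r := L)) => x; rewrite evD evM ev0 raddf0 addr0.
have wi2 : mcomp w i2 = t.
  rewrite compDl -!compA p1i2 p2i2 compm1.
  by apply: (ev_inj (r := L)) => x; rewrite evD evM ev0 raddf0 add0r.
have [|u [uw uU]] := pP _ w.
  by rewrite compB !compA wi1 wi2 sg subrr.
exists u; split=> [|v []]; first by rewrite !compA uw.
rewrite !compA => vs vt; apply: uU.
by rewrite -[LHS]compm1 -i1p1 compDr !compA vs vt.
Qed.

Lemma kernel_semi_stable K A (i : mor K A) :
  is_kernel i -> semi_stable_kernel i.
Proof.
move=> ik B' g; have ie : embedding i by exact: kernel_embedding.
have [B [j [h [po je]]]] := pushout_exists g ie.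
by exists B, j, h; split=> //; exact: embedding_kernel.
Qed.

(** Comparing with the pushout constructed above needs only one map [u] with
    [u j = j0]: when a composite is an embedding, so is its first factor. *)
Lemma pushout_kernel A' A B' B (i : mor A' A) (g : mor A' B') (j : mor B' B)
    (h : mor A B) : is_kernel i -> is_pushout i g j h -> is_kernel j.
Proof.
move=> ik [_ po]; have ie : embedding i by exact: kernel_embedding.
have [B0 [j0 [h0 [[gj0 _] j0e]]]] := pushout_exists g ie.
have [u [[uj _] _]] := po _ _ _ gj0.
apply: embedding_kernel => U /j0e[V oV VU].
exists (ev u @^-1` V); first exact: ev_cont.
by move=> x ux; apply: VU; rewrite /preimage/= -uj evM.
Qed.

Lemma realized_right_quasi_abelian : right_quasi_abelian C.
Proof.
split.
- by split; [exact: zero_object_exists|exact: biproduct_exists].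
- by move=> A B f; have [K [i [? _]]] := kernel_exists f; exists K, i.
- by move=> A B f; have [Q [p [? _]]] := cokernel_exists f; exists Q, p.
- by move=> A' A B' B i g j h; exact: pushout_kernel.
Qed.

Lemma realized_stable_cokernel A B (p : mor A B) :
  semi_stable_cokernel p -> stable_cokernel p.
Proof.
move=> ps; split=> //; have [K [i [ip _]]] := kernel_exists p.
by exists K, i; split=> //; apply: kernel_semi_stable; exists B, p.
Qed.

End Realized.

(** * Completeness through approximating families *)

Lemma zmod_closedP (A : zmodType) (U : set A) :
  zmod_closed [in U] <-> U 0 /\ forall x y, U x -> U y -> U (x - y).
Proof.
split=> [[U0 UB]|[U0 UB]].
  split=> [|x y Ux Uy]; first by move: U0; rewrite !inE.
  by have := UB x y; rewrite !inE; apply.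
split=> [|x y]; rewrite !inE//; exact: UB.
Qed.

Lemma submod_closedP (R : pzRingType) (M : lmodType R) (U : set M) :
  submod_closed [in U] <-> submod U.
Proof.
split=> [[U0 UP]|[U0 UP]].
  split=> [|a x y Ux Uy]; first by move: U0; rewrite !inE.
  by have := UP a x y; rewrite !inE; apply.
split=> [|a x y]; rewrite !inE//; exact: UP.
Qed.

Lemma submod_zmod_closed (R : pzRingType) (M : lmodType R) (U : set M) :
  submod U -> zmod_closed [in U].
Proof.
move=> Us; apply/zmod_closedP; split; first by case: Us.
by move=> x y; exact: submodB.
Qed.

(** Over the integers, submodules are subgroups; this is what makes abelian
    groups the case R = int. *)
Lemma zmod_closed_submod (A : zmodType) (U : set A) :
  zmod_closed [in U] <-> @submod int (zmodule A) U.
Proof.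
split=> [/zmod_closedP[U0 UB]|]; last exact: submod_zmod_closed.
have UN x : U x -> U (- x) by move=> Ux; rewrite -sub0r; exact: UB.
have UD x y : U x -> U y -> U (x + y).
  by move=> Ux Uy; rewrite -(opprK y); apply: UB => //; exact: UN.
have Un x n : U x -> U (x *+ n).
  by move=> Ux; elim: n => [|n IH]; rewrite ?mulr0n// mulrS; exact: UD.
split=> // a x y Ux Uy; rewrite scalezrE; apply: UD => //.
by case: a => n; rewrite /intmul; [|apply: UN]; exact: Un.
Qed.

Lemma add_coset_eqP (A : zmodType) (U : set A) (a b : A) :
  zmod_closed [in U] -> (add_coset U a = add_coset U b <-> U (a - b)).
Proof.
move=> /zmod_closedP[U0 UB]; split=> [abU|Uab].
  have : add_coset U a a by exists 0; rewrite ?addr0.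
  by rewrite abU => -[u Uu <-]; rewrite addrC addKr.
have UN x : U x -> U (- x) by move=> Ux; rewrite -sub0r; exact: UB.
apply/seteqP; split=> _ [u Uu <-].
  exists (a - b + u); last by rewrite addrCA addrA subrK addrC.
  by rewrite -[u]opprK; apply: UB => //; exact: UN.
exists (u - (a - b)); first exact: UB.
by rewrite opprB addrCA subrKC addrC.
Qed.

Lemma completion_eq (A : zmodType) (F : set (set A)) (c c' : completion F) :
  (forall U, sval (c U) = sval (c' U)) -> c = c'.
Proof.
case: c c' => [c cP] [c' c'P] /= cc'.
have e : c = c'.
  by apply: functional_extensionality_dep => U; apply: eq_sig_hprop => // *;
    exact: Prop_irrelevance.
by subst c'; congr Completion; exact: Prop_irrelevance.
Qed.

Lemma to_completion_eqP (A : zmodType) (F : set (set A)) (a b : A) :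
  (forall U, F U -> zmod_closed [in U]) ->
  to_completion F a = to_completion F b <-> forall U, F U -> U (a - b).
Proof.
move=> FS; split=> [ab U FU|ab].
  apply/(add_coset_eqP _ _ (FS U FU)).
  exact: (congr1 (fun c : completion F => sval (c (exist _ U FU))) ab).
apply: completion_eq => -[U FU] /=.
by apply/(add_coset_eqP _ _ (FS U FU)); exact: ab.
Qed.

Lemma is_separatedP (A : zmodType) (F : set (set A)) :
  (forall U, F U -> zmod_closed [in U]) ->
  is_separated F <-> forall x, (forall U, F U -> U x) -> x = 0.
Proof.
move=> FS; split=> [sep x Fx|sep a b /(to_completion_eqP _ _ FS) ab].
  by apply: sep; apply/(to_completion_eqP _ _ FS) => U FU; rewrite subr0; exact: Fx.
by apply/eqP; rewrite -subr_eq0; apply/eqP; exact: sep.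
Qed.

(** A point of the completion is a compatible family of cosets; choosing an
    element in each coset turns it into a compatible family of elements. *)
Lemma is_completeP (A : zmodType) (F : set (set A)) :
  (forall U, F U -> zmod_closed [in U]) ->
  is_complete F <-> forall y : set A -> A,
    (forall U V, F U -> F V -> U `<=` V -> V (y U - y V)) ->
    exists x, forall U, F U -> U (x - y U).
Proof.
move=> FS; split=> [cF y yP|cF c].
  have yc (U V : {U : set A | F U}) : sval U `<=` sval V ->
      sval (to_add_quotient (sval U) (y (sval U))) `<=`
      sval (to_add_quotient (sval V) (y (sval V))).
    case: U V => [U FU] [V FV] /= UV _ [u Uu <-].
    have -> : add_coset V (y V) = add_coset V (y U).
      apply/esym/(add_coset_eqP _ _ (FS V FV)); exact: yP.
    by exists u => //; exact: UV.
  have [x xP] := cF (Completion yc); exists x => U FU.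
  apply/(add_coset_eqP _ _ (FS U FU)).
  exact: (congr1 (fun c : completion F => sval (c (exist _ U FU))) xP).
have /choice[y yP] : forall U, exists a, forall FU : F U,
    sval (c (exist _ U FU)) = add_coset U a.
  move=> U; have [FU|nU] := pselect (F U); last by exists 0.
  have [a aE] := svalP (c (exist _ U FU)); exists a => FU'.
  by rewrite (Prop_irrelevance FU' FU).
have [U V FU FV UV|x xP] := cF y.
  have [V0 _] := (zmod_closedP V).1 (FS V FV).
  have [U0 _] := (zmod_closedP U).1 (FS U FU).
  have := @completion_compat _ _ c (exist _ U FU) (exist _ V FV) UV.
  rewrite !yP => /(_ (y U)) [|v Vv <-]; first by exists 0; rewrite ?addr0.
  by rewrite addrC addKr.
exists x; apply: completion_eq => -[U FU] /=; rewrite yP.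
by apply/(add_coset_eqP _ _ (FS U FU)); exact: xP.
Qed.

(** * Linear topologies and topological groups *)

Section LinearTopology.
Variable A : topologicalZmodType.

Lemma nbhs_translate (x : A) (P : set A) :
  nbhs x P <-> nbhs (0 : A) [set y | P (x + y)].
Proof.
have tc (a : A) : continuous (fun y : A => y - a).
  move=> y; apply: (@continuous_comp _ _ _ (fun y => (y, a))
    (fun z : A * A => z.1 - z.2)); last exact: sub_continuous.
  by apply: cvg_pair; [exact: cvg_id|exact: cvg_cst].
split=> Px.
  have h := tc (- x) 0; rewrite /continuous_at sub0r opprK in h.
  have {}h : nbhs (0 : A) [set y | P (y + x)] := h _ Px.
  by apply: filterS h => y /=; rewrite addrC.
have h := tc x x; rewrite /continuous_at subrr in h.
have {}h : nbhs x [set y | P (x + (y - x))] := h _ Px.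
by apply: filterS h => y /=; rewrite subrKC.
Qed.

Lemma open_zmod_closed (U V : set A) :
  zmod_closed [in V] -> open U -> U 0 -> U `<=` V -> open V.
Proof.
move=> /zmod_closedP[V0 VB] oU U0 UV; rewrite openE => x Vx.
apply/nbhs_translate; apply: filterS (open_nbhs_nbhs (conj oU U0)) => y /UV Vy /=.
by rewrite -(opprK y); apply: (VB _ _) => //; rewrite -sub0r; exact: VB.
Qed.

End LinearTopology.

(** For additive maps continuity can be tested at zero, hence on a base of
    neighborhoods of zero. *)
Lemma continuous_base (A B : topologicalZmodType) (F : set (set B))
    (f : A -> B) :
  base_at_zero F -> (forall U, F U -> open U /\ U 0) -> zmod_morphism f ->
  (forall U, F U -> open (f @^-1` U)) -> continuous f.
Proof.
move=> Fb FU fB fU x P /nbhs_translate/Fb[U FUU UP].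
have f0 : f 0 = 0 by rewrite -(subrr 0) fB subrr.
have fD u v : f (u + v) = f u + f v.
  by rewrite -{1}(opprK v) -{1}(sub0r v) !fB f0 opprB subr0.
have [_ U0] := FU _ FUU.
apply/nbhs_translate; apply: filterS (open_nbhs_nbhs (conj (fU _ FUU) _)).
  by move=> y /UP /=; rewrite fD.
by rewrite /preimage/= f0.
Qed.

Section LinSpace.
Variables (R : pzRingType) (M : lmodType R) (O : set (set M)).

(** The module M with the topology for which the cosets of the members of O are
    a base; the proof [OT] is a parameter so that the topological structure can
    be attached to the type. *)
Definition lin_space (OT : lin_top O) : Type := M.

Variable OT : lin_top O.
Local Notation S := (lin_space OT).

HB.instance Definition _ := GRing.Lmodule.copy S M.

Definition lin_nbhs (x : S) : set (set S) :=
  [set P | exists2 U, O U & forall y, U (y - x) -> P y].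

HB.instance Definition _ := hasNbhs.Build S lin_nbhs.

Let lin_nbhs_filter (x : S) : ProperFilter (nbhs x).
Proof.
split.
  by move=> [U /(lin_topS OT)[U0 _] /(_ x)]; apply; rewrite subrr.
split.
- by exists setT => //; exact: (lin_topT OT).
- move=> P Q [U OU UP] [V OV VQ]; exists (U `&` V); first exact: (lin_topI OT).
  by move=> y [/UP ? /VQ ?].
- by move=> P Q PQ [U OU UP]; exists U => // y /UP/PQ.
Qed.

Let lin_nbhs_singleton (x : S) (P : set S) : nbhs x P -> P x.
Proof. by move=> [U /(lin_topS OT)[U0 _]]; apply; rewrite subrr. Qed.

Let lin_nbhs_nbhs (x : S) (P : set S) : nbhs x P -> nbhs x (nbhs^~ P).
Proof.
move=> [U OU UP]; exists U => // y Uy; exists U => // z Uz; apply: UP.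
exact: submod_trans (lin_topS OT OU) Uz Uy.
Qed.

HB.instance Definition _ := Nbhs_isNbhsTopological.Build S
  lin_nbhs_filter lin_nbhs_singleton lin_nbhs_nbhs.

Let lin_sub_continuous : continuous (fun x : S * S => x.1 - x.2).
Proof.
move=> [x y] P [U OU UP] /=; have Us := lin_topS OT OU.
exists ([set z | U (z - x)], [set z | U (z - y)]) => /=.
  by split; exists U.
move=> [z t] /= [Uz Ut]; apply: UP.
by rewrite /= opprD addrACA -opprD; exact: submodB.
Qed.

HB.instance Definition _ :=
  PreTopologicalNmodule_isTopologicalZmodule.Build S lin_sub_continuous.

End LinSpace.

Lemma lin_space_open (R : pzRingType) (M : lmodType R) (O : set (set M))
    (OT : lin_top O) (U : set M) :
  submod U -> (@open (lin_space OT) U <-> O U).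
Proof.
move=> Us; split=> [oU|OU].
  have [] : nbhs (0 : lin_space OT) U.
    by apply: open_nbhs_nbhs; split=> //; case: Us.
  move=> V OV VU; apply: (lin_top_up OT OV) => // x Vx; apply: VU.
  by rewrite subr0.
rewrite openE => x Ux; exists U => // y Uyx.
by rewrite -(subrK x y); exact: submodD.
Qed.

Lemma lin_space_base (R : pzRingType) (M : lmodType R) (O : set (set M))
    (OT : lin_top O) (N : set (lin_space OT)) :
  nbhs (0 : lin_space OT) N -> exists2 U, O U & U `<=` N.
Proof.
move=> [U OU UN]; exists U => // x Ux; apply: UN.
by rewrite subr0.
Qed.

(** * Topological abelian groups *)

Lemma open_subgroupS (A : topologicalZmodType) (U : set A) :
  open_subgroup U -> zmod_closed [in U].
Proof. by case. Qed.

Lemma open_subgroup_lin_top (A : topscZ) :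
  @lin_top int (zmodule A) (@open_subgroup A).
Proof.
split.
- by move=> U [_ /zmod_closed_submod].
- split; first exact: openT.
  by apply/zmod_closedP.
- move=> U V [oU Us] [oV Vs]; split; first exact: openI.
  by apply/zmod_closed_submod/submodI; exact/zmod_closed_submod.
- move=> U V [oU /zmod_closedP[U0 _]] /zmod_closed_submod Vs UV; split=> //.
  exact: open_zmod_closed UV.
- exact: (is_separatedP (@open_subgroupS A)).1 (@topscZ_separated A).
- exact: (is_completeP (@open_subgroupS A)).1 (@topscZ_complete A).
Qed.

Lemma homZ_linear (A B : topscZ) (f : homZ A B) :
  linear (f : zmodule A -> zmodule B).
Proof. by move=> a x y; rewrite !scalezrE raddfD/= raddfMz. Qed.

Lemma homZ_preimage (A B : topscZ) (f : homZ A B) (U : set B) :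
  open_subgroup U -> open_subgroup (f @^-1` U).
Proof.
move=> [oU /zmod_closed_submod Us]; split.
  by apply: open_comp => // x _; exact: homZ_continuous.
by apply/zmod_closed_submod/(submod_preimage _ Us); exact: homZ_linear.
Qed.

Lemma homZ_full (A B : topscZ) (h : zmodule A -> zmodule B) : linear h ->
  (forall U, open_subgroup (U : set B) -> open_subgroup (h @^-1` U : set A)) ->
  exists f : homZ A B, f =1 h.
Proof.
move=> hL hU; have hB : @zmod_morphism A B h.
  by move=> x y; have := hL (-1) y x; rewrite !scaleN1r => e;
    rewrite addrC [RHS]addrC; exact: e.
suff hC : h \in @cont_additive A B by exists (HomZ hC).
apply/cont_additiveP; split=> //.
apply: (continuous_base (@topscZ_linear B)) => // [U [oU /zmod_closedP[]]//|].
by move=> U /hU[].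
Qed.

(** An abelian group has only one structure of module over the integers, so the
    structure that comes with M agrees with the one built on its group. *)
Lemma topscZ_realized (M : lmodType int) (O : set (set M)) : lin_top O ->
  exists (A : topscZ) (e : M -> zmodule A) (e' : zmodule A -> M),
    [/\ linear e, cancel e e', cancel e' e &
        forall W, @open_subgroup A W <-> O (e @^-1` W)].
Proof.
move=> OT.
have smE (U : set M) : zmod_closed [in U] <-> submod U.
  rewrite zmod_closed_submod; split=> -[U0 UP]; split=> // a x y Ux Uy.
    by rewrite -[a]intz scaler_int; exact: UP.
  by rewrite scalezrE -scaler_int; exact: UP.
have osE : @open_subgroup (lin_space OT) = O.
  apply/seteqP; split=> U.
    by move=> [oU /smE Us]; exact: (lin_space_open OT Us).1 oU.
  move=> OU; have Us := lin_topS OT OU; split; last exact/smE.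
  exact: (lin_space_open OT Us).2 OU.
have OS U : O U -> zmod_closed [in U] by move=> /(lin_topS OT)/smE.
have lin : base_at_zero (@open_subgroup (lin_space OT)).
  by rewrite osE => N /lin_space_base.
have sep : is_separated (@open_subgroup (lin_space OT)).
  by rewrite osE; apply/(is_separatedP OS); exact: lin_top_sep OT.
have cpl : is_complete (@open_subgroup (lin_space OT)).
  by rewrite osE; apply/(is_completeP OS); exact: lin_top_compl OT.
exists (TopscZ lin sep cpl), id, id; split=> //.
- move=> a x y; have ax : a *: x = x *~ a by rewrite -{1}[a]intz scaler_int.
  exact: (congr1 (+%R^~ y) ax).
- by move=> W; rewrite -[open_subgroup W]/(@open_subgroup (lin_space OT) W) osE.
Qed.

Definition topscZ_realization : realization int TopscZ_cat :=
  @Realization int TopscZ_cat (fun A : topscZ => zmodule A)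
    (fun A : topscZ => @open_subgroup A)
    (fun A B : topscZ => @homZ_fun A B) open_subgroup_lin_top
    homZ_linear homZ_preimage
    (fun A B : topscZ => @homZ_ext A B) homZ_full
    (fun (A : topscZ) (x : A) => erefl x)
    (fun (A B D : topscZ) (g : homZ B D) (f : homZ A B) x => erefl (g (f x)))
    (fun (A B : topscZ) (f g : homZ A B) x => erefl (f x + g x))
    topscZ_realized.

(** * Topological vector spaces *)

Section Topsck.
Variable k : fieldType.

Lemma open_subspaceS (V : topVect k) (U : set V) :
  open_subspace U -> zmod_closed [in U].
Proof. by case=> _ /submod_closedP/submod_zmod_closed. Qed.

Lemma open_subspace_lin_top (V : topsck k) : lin_top (@open_subspace k V).
Proof.
split.
- by move=> U [_ /submod_closedP].
- split; first exact: openT.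
  by apply/submod_closedP; exact: submodT.
- move=> U W [oU /submod_closedP Us] [oW /submod_closedP Ws].
  by split; [exact: openI|exact/submod_closedP/submodI].
- move=> U W [oU /submod_closedP[U0 _]] Ws UW; split; last exact/submod_closedP.
  exact: (open_zmod_closed (submod_zmod_closed Ws) oU).
- exact: (is_separatedP (@open_subspaceS V)).1 (@topsck_separated k V).
- exact: (is_completeP (@open_subspaceS V)).1 (@topsck_complete k V).
Qed.

Lemma homk_preimage (V W : topsck k) (f : homk V W) (U : set W) :
  open_subspace U -> open_subspace (f @^-1` U).
Proof.
move=> [oU /submod_closedP Us]; split.
  by apply: open_comp => // x _; exact: homk_continuous.
by apply/submod_closedP/(submod_preimage _ Us); exact: homk_linear.
Qed.

Lemma homk_full (V W : topsck k) (h : V -> W) : linear h ->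
  (forall U, open_subspace U -> open_subspace (h @^-1` U)) ->
  exists f : homk V W, f =1 h.
Proof.
move=> hL hU.
suff hC : h \in @cont_linear k V W by exists (Homk hC).
apply/cont_linearP; split=> //.
apply: (continuous_base (@topsck_linear k W)).
- by move=> U [oU /submod_closedP[]].
- by move=> x y; have := hL (-1) y x; rewrite !scaleN1r => e;
    rewrite addrC [RHS]addrC; exact: e.
- by move=> U /hU[].
Qed.

Definition lin_space_lmod (M : lmodType k) (O : set (set M)) (OT : lin_top O) :
    GRing.Zmodule_isLmodule k (lin_space OT) :=
  @GRing.Zmodule_isLmodule.Build k (lin_space OT) (@GRing.scale k M)
    (@scalerA k M) (@scale1r k M) (@scalerDr k M) (@scalerDl k M).

Lemma lin_space_scale_continuous (M : lmodType k) (O : set (set M))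
    (OT : lin_top O) :
  continuous (fun z : discrete_topology k * lin_space OT =>
    GRing.Zmodule_isLmodule.scale (lin_space_lmod OT) z.1 z.2).
Proof.
move=> [a x] P [U OU UP] /=; have Us := lin_topS OT OU.
exists ([set a], [set z | U (z - x)]) => /=.
  split; last by exists U.
  exact/principal_filterP.
move=> [b z] /= [-> Uz]; apply: UP.
rewrite -[_ - _]/(a *: (z : M) - a *: (x : M)) -scalerBr; exact: submodZ.
Qed.

Lemma topsck_realized (M : lmodType k) (O : set (set M)) : lin_top O ->
  exists (V : topsck k) (e : M -> V) (e' : V -> M),
    [/\ linear e, cancel e e', cancel e' e &
        forall W, @open_subspace k V W <-> O (e @^-1` W)].
Proof.
move=> OT; pose V := TopVect (@lin_space_scale_continuous M O OT).
have osE : @open_subspace k V = O.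
  apply/seteqP; split=> U.
    by move=> [oU /submod_closedP Us]; exact: (lin_space_open OT Us).1 oU.
  move=> OU; have Us := lin_topS OT OU; split; last exact/submod_closedP.
  exact: (lin_space_open OT Us).2 OU.
have OS U : O U -> zmod_closed [in U].
  by move=> /(lin_topS OT)/submod_zmod_closed.
have lin : base_at_zero (@open_subspace k V).
  by rewrite osE => N N0; exact: (lin_space_base (OT := OT) N0).
have sep : is_separated (@open_subspace k V).
  by rewrite osE; apply/(is_separatedP OS); exact: lin_top_sep OT.
have cpl : is_complete (@open_subspace k V).
  by rewrite osE; apply/(is_completeP OS); exact: lin_top_compl OT.
exists (Topsck lin sep cpl), id, id; split=> //.
by move=> W; rewrite -[open_subspace W]/(@open_subspace k V W) osE.
Qed.

Definition topsck_realization : realization k (Topsck_cat k) :=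
  @Realization k (Topsck_cat k) (fun V : topsck k => V)
    (fun V : topsck k => @open_subspace k V)
    (fun V W : topsck k => @homk_fun k V W) open_subspace_lin_top
    (fun V W : topsck k => @homk_linear k V W) homk_preimage
    (fun V W : topsck k => @homk_ext k V W) homk_full
    (fun (V : topsck k) (x : V) => erefl x)
    (fun (U V W : topsck k) (g : homk V W) (f : homk U V) x => erefl (g (f x)))
    (fun (V W : topsck k) (f g : homk V W) x => erefl (f x + g x))
    topsck_realized.

End Topsck.

Theorem proposition8p3 (k : fieldType) :
  [/\ right_quasi_abelian TopscZ_cat,
      (forall (A B : TopscZ_cat) (i : mor A B),
         is_kernel i -> semi_stable_kernel i)
    & (forall (A B : TopscZ_cat) (p : mor A B),
         semi_stable_cokernel p -> stable_cokernel p)] /\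
  [/\ right_quasi_abelian (Topsck_cat k),
      (forall (A B : Topsck_cat k) (i : mor A B),
         is_kernel i -> semi_stable_kernel i)
    & (forall (A B : Topsck_cat k) (p : mor A B),
         semi_stable_cokernel p -> stable_cokernel p)].
Proof.
have H (R : pzRingType) (C : preadditive) (L : realization R C) :
    [/\ right_quasi_abelian C,
        (forall (A B : C) (i : mor A B), is_kernel i -> semi_stable_kernel i)
      & (forall (A B : C) (p : mor A B),
           semi_stable_cokernel p -> stable_cokernel p)].
  split; first exact: realized_right_quasi_abelian L.
    by move=> A B i; exact: (@kernel_semi_stable R C L A B i).
  by move=> A B p; exact: (@realized_stable_cokernel R C L A B p).
by split; apply: H; [exact: topscZ_realization|exact: topsck_realization].
Qed.
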